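(* Let $M\in\mathbb{C}$ satisfy $\Re M>0$, and let $$b_0=0,\qquad b_1=1,\qquad b_2=2M-1,\qquad b_n=\frac{2M}{n-1}\quad\text{for } n\in\{3,4,\ldots\}.$$ Then the continued fraction $\mathop{\mathbf{K}}_{n=1}^{\infty}\frac{1}{b_n}$ converges and $$2M\,\Phi(-1,1,M+1)=\mathop{\mathbf{K}}_{n=1}^{\infty}\frac{1}{b_n}.$$
   Context: The Lerch transcendent is $\Phi(z,s,a)=\sum_{n=0}^{\infty}\frac{z^n}{(n+a)^s}$ for $a\notin\{0,-1,-2,\ldots\}$; in particular $\Phi(-1,1,M+1)=\sum_{n=0}^\infty \frac{(-1)^n}{n+M+1}$, the (conditionally convergent) series being the limit of its partial sums. For complex sequences $(a_n)_{n\ge1}$, $(b_n)_{n\ge 0}$, the continued fraction $b_0+\mathop{\mathbf{K}}_{n=1}^{\infty}\frac{a_n}{b_n}=b_0+\cfrac{a_1}{b_1+\cfrac{a_2}{b_2+\cdots}}$ has convergents $f_n=A_n/B_n$, where $A_{-1}=1$, $A_0=b_0$, $B_{-1}=0$, $B_0=1$, and $A_n=b_nA_{n-1}+a_nA_{n-2}$, $B_n=b_nB_{n-1}+a_nB_{n-2}$ for $n\ge1$. The continued fraction converges, with value $f$, if $\lim_{n\to\infty}f_n=f$ exists. Here all partial numerators are $a_n=1$. *)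

(* Defs.v *)
From Stdlib Require Import Reals.
From Coquelicot Require Import Coquelicot.

Local Open Scope C_scope.

(** [is_lerch_phi z s a v]: the Lerch transcendent
    Phi(z,s,a) = sum_(n >= 0) z^n / (n+a)^s is defined at [a], its series
    converges (possibly only conditionally), and its sum is [v].
    The exponent [s] is a natural number, so that no branch of the complex
    power has to be chosen. *)
Definition is_lerch_phi (z : C) (s : nat) (a v : C) : Prop :=
  (forall k : nat, a <> - RtoC (INR k)) /\
  is_series (fun n : nat => Cpow z n / Cpow (RtoC (INR n) + a) s) v.

(** The pair (X_(n-1), X_n) of consecutive terms of the solution of
    X_n = b_n X_(n-1) + a_n X_(n-2) (n >= 1) with X_(-1) = x and X_0 = y.
    The index is shifted by a pair because X_(-1) is part of the data. *)
Fixpoint cfrac_rec (a b : nat -> C) (x y : C) (n : nat) : C * C :=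
  match n with
  | O => (x, y)
  | S m =>
      let p := cfrac_rec a b x y m in
      (snd p, b n * snd p + a n * fst p)
  end.

Definition cfrac_num (a b : nat -> C) (n : nat) : C :=
  snd (cfrac_rec a b 1 (b 0%nat) n).

Definition cfrac_den (a b : nat -> C) (n : nat) : C :=
  snd (cfrac_rec a b 0 1 n).

(** [is_cfrac a b f]: the continued fraction b_0 + K_(n >= 1) (a_n / b_n)
    converges to [f]; the value [a 0] is irrelevant.  Since division is total,
    the condition that B_n is eventually nonzero is needed for the convergents
    A_n / B_n to be genuine quotients. *)
Definition is_cfrac (a b : nat -> C) (f : C) : Prop :=
  eventually (fun n : nat => cfrac_den a b n <> 0) /\
  filterlim (fun n : nat => cfrac_num a b n / cfrac_den a b n)
    eventually (locally f).

(* Main.v *)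
Require Import Defs.
From Stdlib Require Import Reals Lra Lia.
From Coquelicot Require Import Coquelicot.

(** Write A_n / B_n for the convergents, and d_n = A_(n+1), c_n = B_(n+1).  Both
    sequences solve X_(n+2) = 2M / (n+2) X_(n+1) + X_n, with c_0 = 1, c_1 = 2M,
    d_0 = 1, d_1 = 2M - 1.  The idea is to exhibit a third solution e_n that
    is bounded, and to see that d - K c = e for K = 2M Phi(-1,1,M+1); then
    A/B - K = e/c, and it remains to see that e/c tends to 0.

    The bounded solution is
      e_n = (-1)^n (n+1) int_0^1 ((1-t)/(1+t))^M t^n dt,
    found by solving the differential equation of the generating function of d_n.
    Since the M-th power has modulus at most 1, |e_n| <= 1
    ([bounded_sol_bounded]).  In the variable x = (1-t)/(1+t) this is a moment of
    x^M against a rational function of x, and so is the Lerch value: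
    Phi(-1,1,M+1) = int_0^1 x^M / (1+x) dx, by expanding 1 / (1+x) in a finite
    geometric series with remainder ([lerch_series]).  One integration by
    parts, [moment_by_parts], yields everything about these moments: the recurrence
    for e_n, its initial condition e_1 = 2M e_0 - 1, and e_0 = 1 - 2M Phi.  As the
    solutions d and e + 2M Phi c agree at 0 and 1, they are equal.

    For the quotient e/c, the product P_n = Re (c_(n+1) conj c_n) is used.  It starts
    at 2 Re M > 0, and the recurrence gives
      P_(n+1) = P_n + 2 Re M / (n+2) |c_(n+1)|^2,
    so P_n increases; then |c_n|^2 + |c_(n+1)|^2 >= 2 P_n is bounded below, so the
    increments dominate a harmonic series and P_n tends to infinity
    ([energy_unbounded]).  In particular no c_n vanishes.  The Casoratian of c and
    e has modulus 1, and with it |e_n| <= 1 turns into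
    |z|^2 P_n <= 1 + |z| for z = e_(n+1) / c_(n+1), so e/c tends to 0
    ([bounded_ratio_to_0]). *)

Local Open Scope C_scope.

(** * Solutions of three-term recurrences *)

Definition three_term (beta X : nat -> C) : Prop :=
  forall n : nat, X (S (S n)) = beta n * X (S n) + X n.

(** This is |c_n|^2 times the real part of c_(n+1) / c_n.  Since that ratio obeys
    r_(n+1) = beta_n + 1 / r_n, coefficients beta_n in the right half-plane
    keep it there; the energy is the quantity that measures by how much. *)
Definition energy (c : nat -> C) (n : nat) : R := Re (c (S n) * Cconj (c n)).

Lemma energy_step (beta c : nat -> C) (n : nat) :
  three_term beta c ->
  energy c (S n) = (energy c n + Re (beta n) * Cmod (c (S n)) ^ 2)%R.
Proof.
  intros Hc. unfold energy. rewrite Hc, Cmod2_alt.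
  destruct (beta n) as [a b], (c (S n)) as [u v], (c n) as [p q].
  unfold Cmult, Cplus, Cconj, Re, Im; simpl; ring.
Qed.

Lemma energy_bound (c : nat -> C) (n : nat) :
  (2 * energy c n <= Cmod (c (S n)) ^ 2 + Cmod (c n) ^ 2)%R.
Proof.
  unfold energy. rewrite !Cmod2_alt.
  destruct (c (S n)) as [u v], (c n) as [p q].
  unfold Cmult, Cconj, Re, Im; simpl.
  assert (A1 := pow2_ge_0 (u - p)). assert (A2 := pow2_ge_0 (v - q)). lra.
Qed.

Lemma ln_diff_le (x : R) : (0 < x)%R -> (ln (x + 1) - ln x <= / x)%R.
Proof.
  intros Hx. rewrite <- ln_div by lra.
  replace ((x + 1) / x)%R with (1 + / x)%R by (field; lra).
  assert (Hi := Rinv_0_lt_compat x Hx).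
  rewrite <- (ln_exp (/ x)) at 2. apply ln_le; [lra|].
  left. apply exp_ineq1. lra.
Qed.

Section Growth.
Context (beta c : nat -> C) (kappa : R) (Hk : (0 < kappa)%R)
  (Hbeta : forall n, (kappa / (INR n + 2) <= Re (beta n))%R)
  (Hc : three_term beta c) (H0 : (0 < energy c 0)%R).

Lemma energy_nondecreasing (n : nat) : (energy c n <= energy c (S n))%R.
Proof.
  rewrite (energy_step beta) by exact Hc.
  assert (Hn := pos_INR n).
  assert (0 < kappa / (INR n + 2))%R by (apply Rdiv_lt_0_compat; lra).
  specialize (Hbeta n). nra.
Qed.

Lemma energy_le (m n : nat) : (m <= n)%nat -> (energy c m <= energy c n)%R.
Proof.
  induction 1; [lra|]. assert (Hm := energy_nondecreasing m0). lra.
Qed.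

(** Two consecutive steps add at least kappa / (n + 3) times
    |c_(n+1)|^2 + |c_(n+2)|^2, a sum which the energy itself bounds from below. *)
Lemma energy_gap (n : nat) :
  (energy c n + 2 * kappa * energy c 0 / (INR n + 3) <= energy c (S (S n)))%R.
Proof.
  rewrite !(energy_step beta) by exact Hc.
  assert (Hn := pos_INR n).
  assert (H1 := Hbeta n). assert (H2 := Hbeta (S n)). rewrite S_INR in H2.
  assert (Hb := energy_bound c (S n)).
  assert (He := energy_le 0 (S n) ltac:(lia)).
  assert (Hq : (0 < kappa / (INR n + 3))%R) by (apply Rdiv_lt_0_compat; lra).
  replace (INR n + 1 + 2)%R with (INR n + 3)%R in H2 by ring.
  assert (H3 : (kappa / (INR n + 3) <= kappa / (INR n + 2))%R).
  { apply Rmult_le_compat_l; [lra|]. apply Rinv_le_contravar; lra. }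
  replace (2 * kappa * energy c 0 / (INR n + 3))%R
    with (kappa / (INR n + 3) * (2 * energy c 0))%R by (field; lra).
  set (q := (kappa / (INR n + 3))%R) in *.
  assert (A1 := pow2_ge_0 (Cmod (c (S n)))).
  assert (A2 := pow2_ge_0 (Cmod (c (S (S n))))).
  nra.
Qed.

(** The gaps are terms of a harmonic series, compared with differences of the
    logarithm.  The gap lemma advances the index by two, so it telescopes on
    the sum of two consecutive energies. *)
Lemma energy_log (n : nat) :
  (2 * kappa * energy c 0 * (ln (INR n + 3) - ln 3)
     <= energy c n + energy c (S n))%R.
Proof.
  induction n as [|n IH].
  - simpl (INR 0). rewrite Rplus_0_l. assert (H := energy_nondecreasing 0). lra.
  - assert (Hg := energy_gap n). rewrite S_INR.
    assert (Hn := pos_INR n).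
    assert (Hl := ln_diff_le (INR n + 3) ltac:(lra)).
    replace (INR n + 1 + 3)%R with (INR n + 3 + 1)%R by ring.
    assert (Hp : (0 < 2 * kappa * energy c 0)%R) by (apply Rmult_lt_0_compat; lra).
    assert (Hm := Rmult_le_compat_l _ _ _ (Rlt_le _ _ Hp) Hl).
    unfold Rdiv in Hg. lra.
Qed.

Lemma energy_unbounded (B : R) : eventually (fun n => (B < energy c n)%R).
Proof.
  set (p := (2 * kappa * energy c 0)%R).
  assert (Hp : (0 < p)%R) by (unfold p; apply Rmult_lt_0_compat; lra).
  destruct (INR_unbounded (exp (2 * B / p + ln 3))) as [N HN].
  exists (S N). intros n Hn.
  assert (He := energy_log N). fold p in He.
  assert (H1 := energy_le (S N) n Hn). assert (H2 := energy_nondecreasing N).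
  assert (Hl : (2 * B / p + ln 3 < ln (INR N + 3))%R).
  { rewrite <- (ln_exp (2 * B / p + ln 3)). apply ln_increasing; [apply exp_pos|lra]. }
  assert (Hm : (p * (2 * B / p) < p * (ln (INR N + 3) - ln 3))%R)
    by (apply Rmult_lt_compat_l; lra).
  replace (p * (2 * B / p))%R with (2 * B)%R in Hm by (field; lra).
  lra.
Qed.

Lemma energy_pos (n : nat) : (0 < energy c n)%R.
Proof. assert (H := energy_le 0 n ltac:(lia)). lra. Qed.

Lemma three_term_neq_0 (n : nat) : c n <> 0.
Proof.
  intros E. assert (H := energy_pos n). unfold energy in H. rewrite E in H.
  unfold Cmult, Cconj, Re in H; simpl in H. lra.
Qed.

End Growth.

Lemma three_term_unique (beta X Y : nat -> C) :
  three_term beta X -> three_term beta Y ->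
  X 0%nat = Y 0%nat -> X 1%nat = Y 1%nat -> forall n, X n = Y n.
Proof.
  intros HX HY E0 E1 n.
  enough (X n = Y n /\ X (S n) = Y (S n)) by tauto.
  induction n as [|n [IH1 IH2]]; [tauto|].
  split; [exact IH2|]. rewrite HX, HY, IH1, IH2. reflexivity.
Qed.

Lemma casoratian (beta c e : nat -> C) (n : nat) :
  three_term beta c -> three_term beta e ->
  c (S n) * e n - e (S n) * c n
    = Cpow (- (1)) n * (c 1%nat * e 0%nat - e 1%nat * c 0%nat).
Proof.
  intros Hc He. induction n as [|n IH].
  - simpl. ring.
  - rewrite Cpow_S, <- Cmult_assoc, <- IH, Hc, He. ring.
Qed.

(** Put z = e_(n+1) / c_(n+1) and let w be the Casoratian, so that
    z c_n = e_n - w / c_(n+1).  Then |z|^2 times the energy of c is the real part of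
    e_(n+1) times the conjugate of z c_n, hence at most
    |e_(n+1)| (|e_n| + 1 / |c_(n+1)|) <= 1 + |z|.  As the energy is unbounded, z is
    small. *)
Lemma bounded_ratio_to_0 (beta c e : nat -> C) (kappa : R) :
  (0 < kappa)%R -> (forall n, (kappa / (INR n + 2) <= Re (beta n))%R) ->
  three_term beta c -> three_term beta e -> (0 < energy c 0)%R ->
  Cmod (c 1%nat * e 0%nat - e 1%nat * c 0%nat) = 1%R ->
  (forall n, (Cmod (e n) <= 1)%R) ->
  forall eps : R, (0 < eps)%R ->
  eventually (fun n => (Cmod (e n / c n) < eps)%R).
Proof.
  intros Hk Hbeta Hc He H0 Hw Hb eps Heps.
  destruct (energy_unbounded beta c kappa Hk Hbeta Hc H0 ((1 + / eps) / eps))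
    as [N HN].
  exists (S N). intros [|n] Hn; [lia|]. specialize (HN n ltac:(lia)).
  assert (Hcn := three_term_neq_0 beta c kappa Hk Hbeta Hc H0).
  set (z := e (S n) / c (S n)).
  assert (Hz : e (S n) = z * c (S n)) by (unfold z; field; apply Hcn).
  set (w := c (S n) * e n - e (S n) * c n).
  assert (Hwn : Cmod w = 1%R).
  { unfold w. rewrite (casoratian beta) by assumption.
    rewrite Cmod_mult, Hw, Cmod_pow, Cmod_m1, pow1. ring. }
  assert (Hzc : z * c n = e n - w / c (S n)) by (unfold z, w; field; apply Hcn).
  assert (HP : (Cmod z ^ 2 * energy c n <= 1 + Cmod z)%R).
  { apply Rle_trans with (Cmod (e (S n) * Cconj (z * c n))).
    - apply Rle_trans with (2 := re_le_Cmod _).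
      apply Rle_trans with (2 := Rle_abs _). right.
      rewrite Hz, Cmod2_alt. unfold energy.
      destruct z as [a b], (c (S n)) as [u v], (c n) as [p q].
      unfold Cmult, Cconj, Re, Im; simpl; ring.
    - rewrite Hzc, Cmod_mult, Cmod_conj.
      assert (Ht : (Cmod (e n - w / c (S n)) <= 1 + / Cmod (c (S n)))%R).
      { eapply Rle_trans; [apply Cmod_triangle|].
        rewrite Cmod_opp, Cmod_div, Hwn by apply Hcn.
        specialize (Hb n). lra. }
      assert (Hzm : (Cmod z = Cmod (e (S n)) * / Cmod (c (S n)))%R)
        by (unfold z; apply Cmod_div, Hcn).
      assert (H1 := Hb (S n)). assert (H2 := Cmod_ge_0 (e (S n))).
      assert (H3 := Rmult_le_compat_l _ _ _ H2 Ht). lra. }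
  (* If |z| >= eps then 1 + |z| <= |z|^2 (1 + 1 / eps) / eps, which is the bound
     that the energy was chosen to exceed. *)
  destruct (Rlt_or_le (Cmod z) eps) as [|Hge]; [assumption|exfalso].
  assert (Hz0 : (0 < Cmod z)%R) by lra.
  assert (Hie := Rinv_0_lt_compat _ Heps).
  assert (H1 : (1 <= / eps * Cmod z)%R).
  { replace 1%R with (/ eps * eps)%R by (field; lra).
    apply Rmult_le_compat_l; lra. }
  unfold Rdiv in HN.
  assert (H2 : (Cmod z ^ 2 * ((1 + / eps) * / eps) < Cmod z ^ 2 * energy c n)%R).
  { apply Rmult_lt_compat_l; [apply pow_lt|]; assumption. }
  nra.
Qed.

(** * Complex functions of a real variable *)

(** [C] as a normed module over the reals, so that complex functions of a real
    variable can be differentiated and integrated. *)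
Local Notation CR := C_R_CompleteNormedModule.

Lemma filterlim_C (u : nat -> C) (l : C) :
  (forall eps : R, (0 < eps)%R -> eventually (fun n => (Cmod (u n - l) < eps)%R)) ->
  filterlim u eventually (locally l).
Proof.
  intros H.
  apply (@filterlim_locally_ball_norm C_AbsRing nat C_NormedModule _ _).
  intros [eps Heps]. exact (H eps Heps).
Qed.

Lemma scal_C (r : R) (z : C) :
  @scal _ CR r z = RtoC r * z.
Proof.
  destruct z as [u v]. unfold RtoC, Cmult; simpl.
  unfold scal; simpl; unfold prod_scal, scal; simpl; unfold mult; simpl.
  f_equal; ring.
Qed.

Lemma norm_C (z : C) : @norm _ CR z = Cmod z.
Proof. symmetry. apply Cmod_norm. Qed.

Lemma is_derive_pair (u v : R -> R) (x du dv : R) :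
  is_derive u x du -> is_derive v x dv ->
  @is_derive R_AbsRing CR (fun t => (u t, v t)) x (du, dv).
Proof.
  intros Hu Hv.
  apply (is_derive_ext (fun t => @plus CR
     (@scal _ CR (u t) (RtoC 1)) (@scal _ CR (v t) Ci))).
  { intros t. rewrite !scal_C. unfold plus; simpl.
    unfold Ci, RtoC, Cmult, prod_plus, plus; simpl. f_equal; ring. }
  replace ((du, dv) : C) with (@plus CR
    (@scal _ CR du (RtoC 1)) (@scal _ CR dv Ci)).
  - apply (@is_derive_plus R_AbsRing CR); apply @is_derive_scal_l; assumption.
  - rewrite !scal_C. unfold plus; simpl.
    unfold Ci, RtoC, Cmult, prod_plus, plus; simpl. f_equal; ring.
Qed.

Lemma is_RInt_Cmult (m : C) (f : R -> C) (a b : R) (v : C) :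
  @is_RInt CR f a b v ->
  @is_RInt CR (fun x => m * f x) a b (m * v).
Proof.
  intros Hf.
  assert (H1 := is_RInt_fct_extend_fst (U := R_NormedModule) (V := R_NormedModule) _ _ _ _ Hf).
  assert (H2 := is_RInt_fct_extend_snd (U := R_NormedModule) (V := R_NormedModule) _ _ _ _ Hf).
  apply (is_RInt_fct_extend_pair (U := R_NormedModule) (V := R_NormedModule)); simpl.
  - exact (is_RInt_minus _ _ _ _ _ _ (is_RInt_scal _ _ _ (fst m) _ H1)
             (is_RInt_scal _ _ _ (snd m) _ H2)).
  - exact (is_RInt_plus _ _ _ _ _ _ (is_RInt_scal _ _ _ (fst m) _ H2)
             (is_RInt_scal _ _ _ (snd m) _ H1)).
Qed.

(** * Complex powers on the unit interval *)

(** The principal power x^z of a positive real x, extended by 0 so that it is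
    continuous at the left end point of the unit interval when Re z > 0. *)
Definition rpow_c (z : C) (x : R) : C :=
  if Rlt_dec 0 x
  then (exp (Re z * ln x) * cos (Im z * ln x), exp (Re z * ln x) * sin (Im z * ln x))%R
  else 0.

Lemma Cmod_rpow_c (z : C) (x : R) : (0 < x)%R -> Cmod (rpow_c z x) = exp (Re z * ln x).
Proof.
  intros Hx. unfold rpow_c. destruct (Rlt_dec 0 x) as [_|]; [|contradiction].
  unfold Cmod; simpl fst; simpl snd. rewrite <- (sqrt_pow2 (exp (Re z * ln x))) at 3
    by (left; apply exp_pos).
  f_equal. assert (H := sin2_cos2 (Im z * ln x)). unfold Rsqr in H.
  transitivity (exp (Re z * ln x) ^ 2
    * (sin (Im z * ln x) * sin (Im z * ln x) + cos (Im z * ln x) * cos (Im z * ln x)))%R;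
    [|rewrite H]; ring.
Qed.

Lemma rpow_c_nonpos (z : C) (x : R) : (x <= 0)%R -> rpow_c z x = 0.
Proof. intros Hx. unfold rpow_c. destruct (Rlt_dec 0 x); [lra|reflexivity]. Qed.

Lemma rpow_c_1 (z : C) : rpow_c z 1 = 1.
Proof.
  unfold rpow_c. destruct (Rlt_dec 0 1); [|lra].
  rewrite ln_1, !Rmult_0_r, exp_0, cos_0, sin_0. unfold RtoC. f_equal; ring.
Qed.

Lemma Cmod_rpow_c_le_1 (z : C) (x : R) :
  (0 <= Re z)%R -> (x <= 1)%R -> (Cmod (rpow_c z x) <= 1)%R.
Proof.
  intros Hz Hx. destruct (Rlt_or_le 0 x) as [H|H].
  - rewrite Cmod_rpow_c by assumption. rewrite <- exp_0.
    apply Rnot_lt_le. intros K. apply exp_lt_inv in K.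
    assert (L : (ln x <= 0)%R) by (rewrite <- ln_1; apply ln_le; assumption).
    nra.
  - rewrite rpow_c_nonpos, Cmod_0 by assumption. lra.
Qed.

Lemma is_derive_rpow_c (z : C) (x : R) : (0 < x)%R ->
  @is_derive R_AbsRing CR (rpow_c z) x (RtoC (/ x) * z * rpow_c z x).
Proof.
  intros Hx.
  apply (is_derive_ext_loc (fun x =>
    (exp (Re z * ln x) * cos (Im z * ln x), exp (Re z * ln x) * sin (Im z * ln x))%R)).
  { exists (mkposreal x Hx). intros y Hy. unfold rpow_c.
    destruct (Rlt_dec 0 y) as [|Hn]; [reflexivity|exfalso].
    unfold ball in Hy; simpl in Hy.
    unfold AbsRing_ball, abs, minus, plus, opp in Hy; simpl in Hy.
    apply Rabs_lt_between in Hy. lra. }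
  unfold rpow_c. destruct (Rlt_dec 0 x) as [_|]; [|contradiction].
  evar (du : R). evar (dv : R).
  replace (RtoC (/ x) * z * _) with ((du, dv) : C).
  - apply is_derive_pair.
    + unfold du. auto_derive; [lra|reflexivity].
    + unfold dv. auto_derive; [lra|reflexivity].
  - destruct z as [a b]. unfold du, dv, RtoC, Cmult; simpl. f_equal; field; lra.
Qed.

Lemma continuous_rpow_c (z : C) (x : R) : (0 < Re z)%R -> (0 <= x)%R ->
  @continuous R_UniformSpace CR (rpow_c z) x.
Proof.
  intros Hz [Hx|<-].
  - apply (@ex_derive_continuous R_AbsRing CR).
    eexists. apply is_derive_rpow_c. assumption.
  - unfold continuous. rewrite rpow_c_nonpos by lra.
    apply (@filterlim_norm_zero R R_AbsRing CR); [typeclasses eauto|].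
    apply filterlim_locally. intros [eps Heps].
    exists (mkposreal (exp (ln eps / Re z)) (exp_pos _)). intros y Hy.
    unfold ball in *; simpl in *; unfold AbsRing_ball, abs, minus, plus, opp in *; simpl in *.
    rewrite norm_C, Ropp_0, Rplus_0_r, Rabs_pos_eq by apply Cmod_ge_0.
    rewrite Ropp_0, Rplus_0_r in Hy. apply Rabs_lt_between in Hy.
    destruct (Rlt_or_le 0 y) as [H|H].
    + rewrite Cmod_rpow_c by assumption. rewrite <- (exp_ln eps) by assumption.
      apply exp_increasing.
      assert (L : (ln y < ln eps / Re z)%R)
        by (rewrite <- (ln_exp (ln eps / Re z)); apply ln_increasing; lra).
      apply (Rmult_lt_compat_l (Re z)) in L; [|assumption].
      replace (Re z * (ln eps / Re z))%R with (ln eps) in L by (field; lra). exact L.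
    + rewrite rpow_c_nonpos, Cmod_0 by assumption. assumption.
Qed.

Lemma rpow_c_succ (z : C) (x : R) : rpow_c (z + 1) x = RtoC x * rpow_c z x.
Proof.
  unfold rpow_c. destruct (Rlt_dec 0 x) as [Hx|]; [|ring].
  destruct z as [a b]. unfold RtoC, Cmult, Cplus, Re, Im; simpl.
  rewrite Rplus_0_r, Rmult_plus_distr_r, Rmult_1_l, exp_plus, exp_ln by assumption.
  f_equal; ring.
Qed.

(** The exponent z + 1 makes this true at x = 0 also: the difference quotient
    there is x^z, which tends to 0.  So the fundamental theorem of calculus
    applies on the closed interval, without an improper integral. *)
Lemma is_derive_rpow_c_succ (z : C) (x : R) : (0 < Re z)%R -> (0 <= x)%R ->
  @is_derive R_AbsRing CR (rpow_c (z + 1)) x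
    ((z + 1) * rpow_c z x).
Proof.
  intros Hz [Hx|<-].
  - replace ((z + 1) * rpow_c z x) with (RtoC (/ x) * (z + 1) * rpow_c (z + 1) x).
    + apply is_derive_rpow_c. assumption.
    + rewrite rpow_c_succ, RtoC_inv by lra. field.
      intros E. apply RtoC_inj in E. lra.
  - rewrite (rpow_c_nonpos z), Cmult_0_r by lra.
    split; [apply is_linear_scal_l|].
    intros y Hy. apply (@is_filter_lim_locally_unique _ R_NormedModule) in Hy. subst y.
    intros eps.
    (* The increment t^(z+1) is t times t^z, and t^z is eventually below eps. *)
    assert (Hcont := continuous_rpow_c z 0 Hz (Rle_refl 0)).
    unfold continuous in Hcont.
    rewrite (@filterlim_locally_ball_norm R_AbsRing R CR _ _) in Hcont.
    generalize (Hcont eps). apply filter_imp. intros t.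
    unfold ball_norm. rewrite !norm_C, !scal_C, !(rpow_c_nonpos _ 0) by lra.
    unfold minus, plus, opp; simpl. unfold norm; simpl; unfold abs; simpl.
    change (Cmod (rpow_c z t + - 0) < eps ->
      Cmod (rpow_c (z + 1) t + - 0 + - (RtoC (t + - 0)%R * 0)) <= eps * Rabs (t + - 0))%R.
    replace (rpow_c z t + - 0) with (rpow_c z t) by ring.
    replace (rpow_c (z + 1) t + - 0 + - (RtoC (t + - 0)%R * 0))
      with (rpow_c (z + 1) t) by ring.
    rewrite rpow_c_succ, Cmod_mult, Cmod_R, Ropp_0, Rplus_0_r.
    intros H. rewrite Rmult_comm. apply Rmult_le_compat_r; [apply Rabs_pos|lra].
Qed.

(** * Moments against x^M *)

Definition moment (M : C) (g : R -> R) (v : C) : Prop :=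
  @is_RInt CR (fun x => @scal _ CR (g x) (rpow_c M x)) 0 1 v.

Definition moment_val (M : C) (g : R -> R) : C :=
  @RInt CR (fun x => @scal _ CR (g x) (rpow_c M x)) 0 1.

(** The factor that makes the solution of the recurrence explicit: in the
    variable t = (1 - x) / (1 + x), one has kern n x dx = - t^n dt. *)
Definition kern (n : nat) (x : R) : R := (2 * ((1 - x) / (1 + x)) ^ n / (1 + x) ^ 2)%R.

Lemma continuous_kern (n : nat) (x : R) : (0 <= x)%R -> continuous (kern n) x.
Proof.
  intros Hx. apply (@ex_derive_continuous R_AbsRing R_NormedModule).
  unfold kern. auto_derive. repeat split; [lra|]. apply Rgt_not_eq. nra.
Qed.

Section Moments.
Context (M : C) (HM : (0 < Re M)%R).

Lemma moment_ext (g h : R -> R) (v : C) :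
  (forall x, (0 <= x <= 1)%R -> g x = h x) -> moment M g v -> moment M h v.
Proof.
  intros E. apply is_RInt_ext. rewrite Rmin_left, Rmax_right by lra.
  intros x Hx. rewrite E by lra. reflexivity.
Qed.

Lemma moment_plus (g h : R -> R) (v w : C) :
  moment M g v -> moment M h w -> moment M (fun x => g x + h x)%R (v + w).
Proof.
  intros Hv Hw. eapply is_RInt_ext; [|exact (is_RInt_plus _ _ _ _ _ _ Hv Hw)].
  intros x _. symmetry. apply (@scal_distr_r R_Ring).
Qed.

Lemma moment_scal (r : R) (g : R -> R) (v : C) :
  moment M g v -> moment M (fun x => r * g x)%R (RtoC r * v).
Proof.
  intros Hv. rewrite <- scal_C.
  eapply is_RInt_ext; [|exact (is_RInt_scal _ _ _ r _ Hv)].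
  intros x _. apply (@scal_assoc R_Ring).
Qed.

Lemma moment_val_correct (g : R -> R) :
  (forall x, (0 <= x <= 1)%R -> continuous g x) -> moment M g (moment_val M g).
Proof.
  intros Hg. apply (@RInt_correct CR), (@ex_RInt_continuous CR).
  rewrite Rmin_left, Rmax_right by lra. intros x Hx.
  apply (@continuous_scal _ R_AbsRing CR); [apply Hg, Hx|].
  apply continuous_rpow_c; lra.
Qed.

(** |x^M| <= 1 on the unit interval. *)
Lemma moment_bound (g h : R -> R) (v : C) (r : R) :
  (forall x, (0 <= x <= 1)%R -> Rabs (g x) <= h x)%R ->
  moment M g v -> is_RInt h 0 1 r -> (Cmod v <= r)%R.
Proof.
  intros Hgh Hv Hr. rewrite <- norm_C.
  refine (norm_RInt_le _ _ 0 1 _ _ Rle_0_1 _ Hv Hr).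
  intros x Hx. rewrite norm_C, scal_C, Cmod_mult, Cmod_R.
  assert (H1 := Hgh x Hx). assert (H2 := Rabs_pos (g x)).
  assert (H3 := Cmod_rpow_c_le_1 M x ltac:(lra) ltac:(lra)).
  assert (H4 := Cmod_ge_0 (rpow_c M x)). nra.
Qed.

(** Here g is the derivative of x G(x), and M G(x) x^M + g(x) x^M is the derivative of
    G(x) x^(M+1).  All identities between moments below are instances for a
    suitable G. *)
Lemma moment_by_parts (G G' g : R -> R) (r : R) (v w : C) :
  (forall x, (0 <= x <= 1)%R -> is_derive G x (G' x)) ->
  (forall x, (0 <= x <= 1)%R -> continuous G' x) ->
  (forall x, (0 <= x <= 1)%R -> g x = G x + x * G' x)%R ->
  G 1%R = r -> moment M g v -> moment M G w -> v + M * w = RtoC r.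
Proof.
  intros HG HG' Hg <- Hv Hw. apply (moment_ext _ _ _ Hg) in Hv.
  assert (H := @is_RInt_scal_derive CR G (rpow_c (M + 1)) G'
    (fun x => (M + 1) * rpow_c M x) 0 1).
  rewrite Rmin_left, Rmax_right in H by lra.
  specialize (H HG (fun t Ht => is_derive_rpow_c_succ M t HM (proj1 Ht)) HG').
  rewrite rpow_c_1, (rpow_c_nonpos _ 0), !scal_C in H by lra.
  assert (HS := is_RInt_plus _ _ _ _ _ _ Hv (is_RInt_Cmult M _ _ _ _ Hw)).
  change (plus v (M * w)) with (v + M * w) in HS.
  replace (RtoC (G 1%R)) with (@minus CR (RtoC (G 1%R) * 1) (RtoC (G 0%R) * 0)).
  - apply (@is_RInt_unique CR) in HS. rewrite <- HS.
    apply (@is_RInt_unique CR).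
    refine (is_RInt_ext _ _ _ _ _ _ (H _)).
    + intros x _. rewrite !scal_C, rpow_c_succ, RtoC_plus, RtoC_mult.
      unfold plus; simpl. change prod_plus with Cplus. ring.
    + intros t Ht.
      apply (@continuous_scal_r R_UniformSpace C_AbsRing C_NormedModule (M + 1)).
      apply continuous_rpow_c; lra.
  - change (RtoC (G 1%R) * 1 + - (RtoC (G 0%R) * 0) = RtoC (G 1%R)). ring.
Qed.

Lemma moment_pow (n : nat) (v : C) :
  moment M (fun x => x ^ n)%R v -> (RtoC (INR n) + (M + 1)) * v = 1.
Proof.
  intros Hv.
  etransitivity; [|apply (moment_by_parts (fun x => x ^ n)%R (fun x => INR n * x ^ pred n)%R
    (fun x => (INR n + 1) * x ^ n)%R 1 (RtoC (INR n + 1) * v) v)].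
  - rewrite RtoC_plus. ring.
  - intros x _. auto_derive; [trivial|]. destruct n; simpl; ring.
  - intros x _. apply (@ex_derive_continuous R_AbsRing R_NormedModule).
    auto_derive. trivial.
  - intros x _. destruct n as [|n]; [simpl; ring|]. rewrite S_INR. simpl. ring.
  - apply pow1.
  - exact (moment_scal _ _ _ Hv).
  - exact Hv.
Qed.

(** Integration by parts with G(x) = 2 / (1 + x): the Lerch value, which is the
    moment of 1 / (1 + x), determines the moment of [kern 0]. *)
Lemma moment_inv_1p (v w : C) :
  moment M (fun x => / (1 + x))%R v ->
  moment M (kern 0) w ->
  w + 2 * M * v = 1.
Proof.
  intros Hv Hw.
  etransitivity; [|apply (moment_by_parts (fun x => 2 * / (1 + x))%R
    (fun x => - 2 / (1 + x) ^ 2)%R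
    (kern 0) 1 w (RtoC 2 * v))].
  - ring.
  - intros x Hx. auto_derive; [lra|]. field; lra.
  - intros x Hx. apply (@ex_derive_continuous R_AbsRing R_NormedModule).
    auto_derive. apply Rgt_not_eq. nra.
  - intros x Hx. unfold kern. simpl. field; lra.
  - field.
  - exact Hw.
  - exact (moment_scal _ _ _ Hv).
Qed.

(** With t = (1 - x) / (1 + x), the function G = 2 * kern n satisfies
    x G(x) = t^n (1 - t^2), because 4 x / (1 + x)^2 = 1 - t^2.  Its derivative
    is (n + 2) * kern (n + 1) - n * kern (n - 1), and G(1) vanishes except for
    n = 0, when it is 1.  This is the source of the recurrence. *)
Lemma moment_kern_0 (u v : C) :
  moment M (kern 0) u -> moment M (kern 1) v ->
  RtoC 2 * v + 2 * M * u = 1.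
Proof.
  intros Hu Hv.
  etransitivity; [|apply (moment_by_parts (fun x => 2 * kern 0 x)%R
    (fun x => - 8 / (1 + x) ^ 3)%R (fun x => 2 * kern 1 x)%R 1 (RtoC 2 * v) (RtoC 2 * u))].
  - ring.
  - intros x Hx. unfold kern. auto_derive; [nra|]. simpl. field; lra.
  - intros x Hx. apply (@ex_derive_continuous R_AbsRing R_NormedModule).
    auto_derive. apply Rgt_not_eq. simpl. nra.
  - intros x Hx. unfold kern. simpl. field; lra.
  - unfold kern; simpl; field.
  - exact (moment_scal _ _ _ Hv).
  - exact (moment_scal _ _ _ Hu).
Qed.

Lemma moment_kern_S (n : nat) (u v w : C) :
  moment M (kern n) u -> moment M (kern (S n)) v -> moment M (kern (S (S n))) w ->
  RtoC (INR n + 3) * w + 2 * M * v - RtoC (INR n + 1) * u = 0.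
Proof.
  intros Hu Hv Hw.
  etransitivity; [|apply (moment_by_parts (fun x => 2 * kern (S n) x)%R
    (fun x => - 2 * ((INR n + 1) * kern n x * (2 / (1 + x) ^ 2)
                     + 2 * kern (S n) x / (1 + x)))%R
    (fun x => (INR n + 3) * kern (S (S n)) x + (- (INR n + 1)) * kern n x)%R
    0 (RtoC (INR n + 3) * w + RtoC (- (INR n + 1)) * u) (RtoC 2 * v))].
  - rewrite RtoC_opp. ring.
  - intros x Hx. unfold kern. auto_derive; [split; [lra|split;trivial]; nra|].
    change (match n with 0%nat => 1%R | S _ => (INR n + 1)%R end) with (INR (S n)).
    rewrite S_INR. simpl. unfold Rminus, Rdiv.
    generalize (((1 + - x) * / (1 + x)) ^ n)%R. intros p. field; lra.
  - intros x Hx.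
    apply (@ex_derive_continuous R_AbsRing R_NormedModule).
    unfold kern. auto_derive.
    repeat split; try lra; apply Rgt_not_eq; nra.
  - intros x Hx. unfold kern. simpl.
    generalize (((1 - x) / (1 + x)) ^ n)%R. intros p. field; lra.
  - unfold kern; simpl; field.
  - exact (moment_plus _ _ _ _ (moment_scal _ _ _ Hw) (moment_scal _ _ _ Hu)).
  - exact (moment_scal _ _ _ Hv).
Qed.

(** The integral of [kern n] over the unit interval is that of t^n. *)
Lemma moment_kern_bound (n : nat) (v : C) :
  moment M (kern n) v -> (INR (S n) * Cmod v <= 1)%R.
Proof.
  intros Hv. rewrite Rmult_comm. apply Rle_div_r; [apply lt_0_INR; lia|].
  apply (moment_bound (kern n) (kern n)); [|exact Hv|].
  - intros x Hx. right. apply Rabs_pos_eq. unfold kern.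
    apply Rdiv_le_0_compat; [|nra].
    apply Rmult_le_pos; [lra|]. apply pow_le. apply Rdiv_le_0_compat; lra.
  - replace (1 / INR (S n))%R
      with (minus (- / INR (S n) * ((1 - 1) / (1 + 1)) ^ S n)%R
        (- / INR (S n) * ((1 - 0) / (1 + 0)) ^ S n)%R).
    + apply (is_RInt_derive (fun x => - / INR (S n) * ((1 - x) / (1 + x)) ^ S n)%R);
        rewrite Rmin_left, Rmax_right by lra; intros x Hx.
      * unfold kern. auto_derive; [lra|].
        change (match n with 0%nat => 1%R | S _ => (INR n + 1)%R end) with (INR (S n)).
        unfold Rminus, Rdiv. generalize (((1 + - x) * / (1 + x)) ^ n)%R. intros p.
        field. split; [lra|]. apply not_0_INR. discriminate.
      * apply continuous_kern; lra.
    + replace ((1 - 1) / (1 + 1))%R with 0%R by field.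
      replace ((1 - 0) / (1 + 0))%R with 1%R by field.
      rewrite pow1, pow_i by lia.
      change (- / INR (S n) * 0 - - / INR (S n) * 1 = 1 / INR (S n))%R.
      unfold Rdiv. ring.
Qed.

(** * The Lerch series as a moment *)

Definition lerch_term (n : nat) : C :=
  Cpow (- (1)) n / Cpow (RtoC (INR n) + (M + 1)) 1.

Lemma moment_lerch_term (n : nat) :
  moment M (fun x => (- x) ^ n)%R (lerch_term n).
Proof.
  assert (Hv : moment M (fun x => x ^ n)%R (moment_val M (fun x => x ^ n)%R)).
  { apply moment_val_correct. intros x _.
    apply (@ex_derive_continuous R_AbsRing R_NormedModule).
    auto_derive. trivial. }
  assert (E := moment_pow n _ Hv). set (v := moment_val M _) in *.
  replace (lerch_term n) with (RtoC ((- (1)) ^ n)%R * v).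
  - refine (moment_ext _ _ _ _ (moment_scal _ _ _ Hv)).
    intros x _. simpl. rewrite <- Rpow_mult_distr. f_equal. ring.
  - unfold lerch_term. rewrite Cpow_1_r, RtoC_pow, RtoC_opp.
    assert (Hn : RtoC (INR n) + (M + 1) <> 0).
    { intros E0. rewrite E0, Cmult_0_l in E. apply RtoC_inj in E. lra. }
    replace v with (/ (RtoC (INR n) + (M + 1)) * ((RtoC (INR n) + (M + 1)) * v))
      by (field; exact Hn).
    rewrite E. field. exact Hn.
Qed.

(** The remainder of the geometric series of 1 / (1 + x) is again an explicit
    function, which makes the convergence of the only conditionally convergent
    Lerch series quantitative. *)
Lemma moment_lerch_remainder (Phi : C) (N : nat) :
  moment M (fun x => / (1 + x))%R Phi ->
  moment M (fun x => (- x) ^ S N / (1 + x))%R (Phi - sum_n lerch_term N).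
Proof.
  intros HP.
  assert (Hstep : forall n s,
    moment M (fun x => (- x) ^ n / (1 + x))%R s ->
    moment M (fun x => (- x) ^ S n / (1 + x))%R (s - lerch_term n)).
  { intros n s Hs.
    replace (s - lerch_term n) with (s + RtoC (- (1))%R * lerch_term n)
      by (rewrite RtoC_opp; ring).
    refine (moment_ext _ _ _ _ (moment_plus _ _ _ _ Hs
      (moment_scal _ _ _ (moment_lerch_term n)))).
    intros x Hx. simpl. field. lra. }
  induction N as [|N IH].
  - rewrite sum_O. apply Hstep. apply (moment_ext (fun x => / (1 + x))%R); [|exact HP].
    intros x Hx. simpl. field. lra.
  - rewrite sum_Sn. change (plus (sum_n lerch_term N) (lerch_term (S N)))
      with (sum_n lerch_term N + lerch_term (S N)).
    replace (Phi - (sum_n lerch_term N + lerch_term (S N)))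
      with (Phi - sum_n lerch_term N - lerch_term (S N)) by ring.
    apply Hstep, IH.
Qed.

Lemma lerch_error (Phi : C) (N : nat) :
  moment M (fun x => / (1 + x))%R Phi ->
  (Cmod (Phi - sum_n lerch_term N) <= / (INR N + 2))%R.
Proof.
  intros HP. assert (HN := pos_INR N).
  apply (moment_bound (fun x => (- x) ^ S N / (1 + x))%R (fun x => x ^ S N)%R).
  - intros x Hx. assert (Hp := pow_le x (S N) ltac:(lra)).
    rewrite Rabs_div by lra. rewrite <- RPow_abs, Rabs_Ropp.
    rewrite (Rabs_pos_eq x), (Rabs_pos_eq (1 + x)) by lra.
    apply Rle_div_l; [lra|]. nra.
  - apply moment_lerch_remainder, HP.
  - replace (/ (INR N + 2))%R
      with (minus (/ (INR N + 2) * 1 ^ S (S N))%R (/ (INR N + 2) * 0 ^ S (S N))%R).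
    + apply (is_RInt_derive (fun x => / (INR N + 2) * x ^ S (S N))%R); intros x _.
      * auto_derive; [trivial|].
        change (match N with 0%nat => 1%R | S _ => (INR N + 1)%R end) with (INR (S N)).
        rewrite S_INR. simpl. field. lra.
      * apply (@ex_derive_continuous R_AbsRing R_NormedModule).
        auto_derive. trivial.
    + rewrite pow1, pow_i by lia.
      change (/ (INR N + 2) * 1 - / (INR N + 2) * 0 = / (INR N + 2))%R. ring.
Qed.

Lemma lerch_series (Phi : C) :
  moment M (fun x => / (1 + x))%R Phi -> is_lerch_phi (- (1)) 1 (M + 1) Phi.
Proof.
  intros HP. split.
  - intros k E. apply (f_equal Re) in E.
    assert (Hk := pos_INR k). destruct M as [a b].
    unfold Cplus, Copp, RtoC, Re in *; simpl in *. lra.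
  - apply filterlim_C. intros eps Heps.
    destruct (INR_unbounded (/ eps)) as [N HN]. exists N. intros n Hn.
    apply le_INR in Hn. assert (Hi := Rinv_0_lt_compat _ Heps).
    change (Cmod (sum_n lerch_term n - Phi) < eps)%R.
    replace (sum_n lerch_term n - Phi) with (- (Phi - sum_n lerch_term n)) by ring.
    rewrite Cmod_opp. eapply Rle_lt_trans; [apply lerch_error, HP|].
    rewrite <- (Rinv_inv eps). apply Rinv_lt_contravar; nra.
Qed.

End Moments.

(** * The continued fraction *)

Lemma cfrac_num_three_term (b : nat -> C) :
  three_term (fun n => b (3 + n)%nat) (fun n => cfrac_num (fun _ => 1) b (S n)).
Proof. intros n. unfold cfrac_num. simpl. ring. Qed.

Lemma cfrac_den_three_term (b : nat -> C) :
  three_term (fun n => b (3 + n)%nat) (fun n => cfrac_den (fun _ => 1) b (S n)).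
Proof. intros n. unfold cfrac_den. simpl. ring. Qed.

(** (-1)^n (n + 1) times the integral of ((1 - t) / (1 + t))^M t^n over 0 <= t <= 1,
    written in the variable x = (1 - t) / (1 + t).  The factor n + 1
    normalises the moment so that it solves the recurrence of the convergents. *)
Definition bounded_sol (M : C) (n : nat) : C :=
  Cpow (- (1)) n * (RtoC (INR n + 1) * moment_val M (kern n)).

Section BoundedSolution.
Context (M : C) (HM : (0 < Re M)%R).

Lemma moment_kern (n : nat) : moment M (kern n) (moment_val M (kern n)).
Proof.
  apply moment_val_correct; [assumption|]. intros x Hx. apply continuous_kern. lra.
Qed.

Lemma bounded_sol_three_term :
  three_term (fun n => 2 * M / RtoC (INR n + 2)) (bounded_sol M).
Proof.
  intros n. unfold bounded_sol.
  assert (E := moment_kern_S M HM n _ _ _ (moment_kern n) (moment_kern (S n))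
    (moment_kern (S (S n)))).
  assert (Hn : RtoC (INR n + 2) <> 0).
  { intros H. apply RtoC_inj in H. assert (H' := pos_INR n). lra. }
  rewrite !S_INR.
  replace (INR n + 1 + 1 + 1)%R with (INR n + 3)%R by ring.
  replace (INR n + 1 + 1)%R with (INR n + 2)%R by ring.
  apply Ceq_minus. rewrite !Cpow_S.
  transitivity (Cpow (- (1)) n * 0); [|ring].
  rewrite <- E. field. exact Hn.
Qed.

Lemma bounded_sol_0 : bounded_sol M 0 = moment_val M (kern 0).
Proof. unfold bounded_sol. simpl. rewrite Rplus_0_l. ring. Qed.

Lemma bounded_sol_1 : bounded_sol M 1 = 2 * M * bounded_sol M 0 - 1.
Proof.
  assert (E := moment_kern_0 M HM _ _ (moment_kern 0) (moment_kern 1)).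
  rewrite bounded_sol_0. unfold bounded_sol. simpl INR.
  replace (1 + 1)%R with 2%R by ring. rewrite Cpow_1_r.
  apply Ceq_minus.
  transitivity (1 - (RtoC 2 * moment_val M (kern 1) + 2 * M * moment_val M (kern 0)));
    [ring|]. rewrite E. ring.
Qed.

Lemma bounded_sol_bounded (n : nat) : (Cmod (bounded_sol M n) <= 1)%R.
Proof.
  assert (Hb := moment_kern_bound M HM n _ (moment_kern n)). rewrite S_INR in Hb.
  assert (Hn := pos_INR n).
  unfold bounded_sol.
  rewrite !Cmod_mult, Cmod_pow, Cmod_m1, pow1, Cmod_R, Rabs_pos_eq by lra. lra.
Qed.

End BoundedSolution.

Theorem theorem1 (M : C) (HM : (0 < Re M)%R) (b : nat -> C)
  (Hb0 : b 0%nat = 0) (Hb1 : b 1%nat = 1) (Hb2 : b 2%nat = 2 * M - 1)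
  (Hb : forall n : nat, (3 <= n)%nat -> b n = 2 * M / (RtoC (INR n) - 1)) :
  exists Phi K : C,
    is_lerch_phi (- (1)) 1 (M + 1) Phi /\
    is_cfrac (fun _ : nat => 1) b K /\
    2 * M * Phi = K.
Proof.
  assert (HPhi : moment M (fun x => / (1 + x))%R (moment_val M (fun x => / (1 + x))%R)).
  { apply moment_val_correct; [assumption|]. intros x Hx.
    apply (@ex_derive_continuous R_AbsRing R_NormedModule). auto_derive. lra. }
  set (Phi := moment_val M _) in HPhi.
  exists Phi, (2 * M * Phi).
  split; [apply lerch_series; assumption|]. split; [|reflexivity].
  (* The coefficients follow the general rule from b_3 on only, so the recurrence
     starts from the convergents of index 1 and 2. *)
  set (beta := fun n : nat => 2 * M / RtoC (INR n + 2)).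
  set (c := fun n => cfrac_den (fun _ => 1) b (S n)).
  set (d := fun n => cfrac_num (fun _ => 1) b (S n)).
  set (e := bounded_sol M).
  assert (Hbeta : forall n, b (3 + n)%nat = beta n).
  { intros n. rewrite Hb by lia. unfold beta. f_equal. f_equal.
    rewrite <- RtoC_minus. f_equal. rewrite plus_INR. simpl. ring. }
  assert (Hc : three_term beta c).
  { intros n. rewrite <- Hbeta. apply cfrac_den_three_term. }
  assert (Hd : three_term beta d).
  { intros n. rewrite <- Hbeta. apply cfrac_num_three_term. }
  assert (He : three_term beta e) by (apply bounded_sol_three_term; assumption).
  assert (Hc0 : c 0%nat = 1) by (unfold c, cfrac_den; simpl; rewrite Hb1; ring).
  assert (Hc1 : c 1%nat = 2 * M)
    by (unfold c, cfrac_den; simpl; rewrite Hb1, Hb2; ring).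
  assert (Hd0 : d 0%nat = 1) by (unfold d, cfrac_num; simpl; rewrite Hb0, Hb1; ring).
  assert (Hd1 : d 1%nat = 2 * M - 1)
    by (unfold d, cfrac_num; simpl; rewrite Hb0, Hb1, Hb2; ring).
  assert (He1 : e 1%nat = 2 * M * e 0%nat - 1) by (apply bounded_sol_1; assumption).
  assert (HK : e 0%nat + 2 * M * Phi = 1).
  { unfold e. rewrite bounded_sol_0.
    exact (moment_inv_1p M HM _ _ HPhi (moment_kern M HM 0)). }
  assert (Hde : forall n, d n = e n + 2 * M * Phi * c n).
  { apply (three_term_unique beta).
    - exact Hd.
    - intros n. rewrite Hc, He. ring.
    - rewrite Hd0, Hc0. rewrite <- HK at 1. ring.
    - rewrite Hd1, Hc1, He1.
      transitivity (2 * M * (e 0%nat + 2 * M * Phi) - 1); [rewrite HK|]; ring. }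
  assert (Hk : (0 < 2 * Re M)%R) by lra.
  assert (HRe : forall n, (2 * Re M / (INR n + 2) <= Re (beta n))%R).
  { intros n. right. unfold beta. assert (Hn := pos_INR n).
    unfold Cdiv. rewrite <- RtoC_inv by lra.
    destruct M as [p q]. unfold Cmult, RtoC, Re; simpl. unfold Rdiv. ring. }
  assert (Hen : (0 < energy c 0)%R).
  { unfold energy. rewrite Hc0, Hc1. destruct M as [p q].
    unfold Cmult, Cconj, RtoC, Re in *; simpl in *. lra. }
  assert (Hcn := three_term_neq_0 beta c _ Hk HRe Hc Hen).
  split.
  - exists 1%nat. intros [|n] Hn; [lia|]. apply (Hcn n).
  - apply filterlim_C. intros eps Heps.
    destruct (bounded_ratio_to_0 beta c e _ Hk HRe Hc He Hen) with (eps := eps)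
      as [N HN]; [|apply bounded_sol_bounded; assumption|exact Heps|].
    + rewrite Hc0, Hc1, He1. transitivity (Cmod 1); [f_equal; ring|apply Cmod_1].
    + exists (S N). intros [|n] Hn; [lia|].
      change (Cmod (d n / c n - 2 * M * Phi) < eps)%R.
      rewrite Hde.
      replace ((e n + 2 * M * Phi * c n) / c n - 2 * M * Phi) with (e n / c n)
        by (field; apply Hcn).
      apply HN. lia.
Qed.
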